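(* Let $\mathbb{F}_q$ be any finite field and let $C\subseteq \mathbb{F}_q^N$ be any transitive linear code. Then for any $\alpha\in(0,1)$, $$\Pr_{c\sim \mathcal{D}(C)}\big[\mathrm{wt}(c)=\alpha N\big]\leq q^{-(1-h_q(\alpha))\dim C},$$ where $\mathcal{D}(C)$ is the uniform distribution over all codewords in $C$, $\mathrm{wt}(c)$ is the number of non-zero coordinates of $c$, and $h_q(\alpha):=(1-\alpha)\log_q\frac{1}{1-\alpha}+\alpha\log_q\frac{q-1}{\alpha}$ is the $q$-ary entropy.
   Context: A linear code $C\subseteq\mathbb{F}_q^N$ is a linear subspace of $\mathbb{F}_q^N$. It is transitive if for every $i,j\in\{1,\dots,N\}$ there is a permutation $\pi$ of $\{1,\dots,N\}$ with $\pi(i)=j$ such that for every $(v_1,\dots,v_N)\in C$ we have $(v_{\pi(1)},\dots,v_{\pi(N)})\in C$. *)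

(* Defs.v *)
From HB Require Import structures.
From mathcomp Require Import all_boot all_order all_algebra all_fingroup.
From mathcomp Require Import all_classical all_reals all_analysis.

Set Implicit Arguments.
Unset Strict Implicit.
Unset Printing Implicit Defensive.

Import Order.TTheory GRing.Theory Num.Theory.
Local Open Scope ring_scope.

(* [col_perm s v] is the row vector (v_(s 0), ..., v_(s (N - 1))). *)
Definition transitive_code (F : finFieldType) (N : nat)
    (C : {vspace 'rV[F]_N}) : Prop :=
  forall i j : 'I_N, exists s : 'S_N,
    s i = j /\ forall v : 'rV[F]_N, v \in C -> col_perm s v \in C.

Definition wt (F : finFieldType) (N : nat) (c : 'rV[F]_N) : nat :=
  #|[set i : 'I_N | c 0 i != 0]|.

Definition uniform_pmf (R : realType) (T : finType) (A : {pred T}) (x : T) : R :=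
  if x \in A then #|A|%:R^-1 else 0.

Definition Pr (R : realType) (T : finType) (D : T -> R) (E : pred T) : R :=
  \sum_(x : T | E x) D x.

Definition logb (R : realType) (b x : R) : R := ln x / ln b.

Definition qentropy (R : realType) (q a : R) : R :=
  (1 - a) * logb q (1 / (1 - a)) + a * logb q ((q - 1) / a).

(* Main.v *)
Require Import Defs.
From HB Require Import structures.
From mathcomp Require Import all_boot all_order all_algebra all_fingroup.
From mathcomp Require Import all_field.
From mathcomp Require Import all_classical all_reals all_analysis.
From mathcomp Require Import ring lra.

Set Implicit Arguments.
Unset Strict Implicit.
Unset Printing Implicit Defensive.

Import Order.TTheory GRing.Theory Num.Theory.
Local Open Scope ring_scope.

(** Let S be the set of codewords of weight alpha N. It is stable under the
    coordinate permutations preserving C, so by transitivity every coordinate is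
    nonzero on exactly alpha |S| words of S. Projecting onto dim C coordinates
    that determine a codeword embeds S in F^(dim C). Give F^(dim C) the product
    distribution in which a symbol is 0 with probability 1 - alpha and is
    otherwise uniform among the q - 1 nonzero symbols. The average over S of the
    log-likelihood is -(dim C) h_q(alpha) ln q, whereas by concavity of ln it is
    at most -ln |S|, because the probabilities of the words of S sum to at
    most 1. Hence |S| <= q^(h_q(alpha) dim C). *)

Lemma ln_prod (R : realType) (I : finType) (p : I -> R) :
  (forall i, 0 < p i) -> ln (\prod_i p i) = \sum_i ln (p i).
Proof.
move=> p_gt0; apply: expR_inj; rewrite lnK ?posrE ?prodr_gt0// expR_sum.
by apply: eq_bigr => i _; rewrite lnK ?posrE.
Qed.

(** Jensen's inequality in tangent-line form: [ln t <= t - 1] at [t = #|S|%:R * Q x], summed over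
    [S], is at most [#|S|%:R * 1 - #|S|%:R = 0]. *)
Lemma card_ln_le (R : realType) (T : finType) (S : {set T}) (Q : T -> R) :
  (forall x, x \in S -> 0 < Q x) -> \sum_(x in S) Q x <= 1 ->
  #|S|%:R * ln #|S|%:R <= - \sum_(x in S) ln (Q x).
Proof.
move=> Q_gt0 Q_le1; have [->|S_neq0] := eqVneq S finset.set0.
  by rewrite big_set0 cards0 mul0r oppr0.
have S_gt0 : 0 < #|S|%:R :> R by rewrite ltr0n card_gt0.
have -> : #|S|%:R * ln #|S|%:R = \sum_(x in S) ln (#|S|%:R : R).
  by rewrite sumr_const mulr_natl.
rewrite -subr_ge0 -opprD oppr_ge0 -big_split /=.
apply: (@le_trans _ _ (\sum_(x in S) (#|S|%:R * Q x - 1))).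
  apply: ler_sum => x Sx; rewrite addrC -lnM ?posrE ?Q_gt0//.
  rewrite -[X in ln X](subrKC 1); apply: le_ln1Dx.
  by rewrite ltrBrDr addNr mulr_gt0 ?Q_gt0.
rewrite sumrB -mulr_sumr sumr_const subr_le0 -[leRHS]mulr1.
by rewrite ler_wpM2l// ltW.
Qed.

(** The generator matrix [B] has rank [\dim C], so that many of its columns form an invertible
    block. The entries of [u *m B] at those columns determine [u], hence the codeword. *)
Lemma information_set (F : finFieldType) (N : nat) (C : {vspace 'rV[F]_N}) :
  exists f : 'I_(\dim C) -> 'I_N,
    {in C &, injective (fun c : 'rV[F]_N => [ffun j => c 0 (f j)])}.
Proof.
pose B := \matrix_(i < \dim C) (vbasis C)`_i.
have mulB (u : 'rV_(\dim C)) : u *m B = \sum_i u 0 i *: (vbasis C)`_i.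
  by rewrite mulmx_sum_row; apply: eq_bigr => i _; rewrite rowK.
have B_free : row_free B.
  apply/inj_row_free => u uB0; apply/rowP => i; rewrite mxE.
  by have /freeP := basis_free (vbasisP C); apply; rewrite -mulB.
have Bt_full : row_full B^T by rewrite /row_full mxrank_tr.
pose f := fullrankfun Bt_full; exists f => c d Cc Cd /ffunP eq_cd.
have exB (x : 'rV[F]_N) : x \in C -> exists u, x = u *m B.
  move=> Cx; exists (\row_i coord (vbasis C) i x); rewrite mulB.
  by rewrite {1}(coord_vbasis Cx); apply: eq_bigr => i _; rewrite mxE.
have [[u def_c] [v def_d]] := (exB c Cc, exB d Cd).
have Bf_free : row_free (colsub f B).
  by rewrite /row_free -mxrank_tr trmx_mxsub; exact: fullrowsub_full.
rewrite def_c def_d; congr (_ *m B); apply: (row_free_inj Bf_free).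
rewrite !mulmx_colsub -def_c -def_d; apply/rowP => j; rewrite !mxE.
by have := eq_cd j; rewrite !ffunE.
Qed.

Lemma wt_col_perm (F : finFieldType) (N : nat) (s : 'S_N) (c : 'rV[F]_N) :
  wt (col_perm s c) = wt c.
Proof.
rewrite /wt -(card_imset _ (@perm_inj _ s)); apply: eq_card => j.
apply/imsetP/idP => [[i + ->]|]; first by rewrite !inE mxE.
by rewrite inE => cj; exists (s^-1%g j); rewrite ?inE ?mxE permKV.
Qed.

Lemma natr_card_setId (R : nzSemiRingType) (T : finType) (A : {set T})
    (P : pred T) : #|[set x in A | P x]|%:R = \sum_(x in A) (P x)%:R :> R.
Proof.
rewrite -sum1_card natr_sum big_mkcond [RHS]big_mkcond /=.
by apply: eq_bigr => x _; rewrite inE; case: (x \in A); case: (P x).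
Qed.

Definition weight_slice (R : realType) (F : finFieldType) (N : nat)
    (C : {vspace 'rV[F]_N}) (alpha : R) : {set 'rV[F]_N} :=
  [set c | (c \in C) && ((wt c)%:R == alpha * N%:R)].

(* Transitivity makes this count independent of [i], and averaging over [i]
   turns the count into the common weight. *)
Lemma card_weight_slice_neq0 (R : realType) (F : finFieldType) (N : nat)
    (C : {vspace 'rV[F]_N}) (alpha : R) (i : 'I_N) :
  transitive_code C ->
  #|[set c in weight_slice C alpha | c 0 i != 0]|%:R
    = alpha * #|weight_slice C alpha|%:R.
Proof.
set S := weight_slice C alpha => hC.
pose n j := #|[set c in S | c 0 j != 0]|.
have n_le j k : (n j <= n k)%N.
  (* Since [s k = j], entry [k] of [col_perm s c] is entry [j] of [c]. Thus [col_perm s] injects the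
     words counted by [n j] into those counted by [n k]. *)
  have [s [skj sC]] := hC k j.
  have s_inj : injective (@col_perm F 1 N s).
    move=> c d eq_cd; apply/rowP => l.
    by move/rowP: eq_cd => /(_ (s^-1%g l)); rewrite !mxE permKV.
  rewrite /n -(card_imset _ s_inj); apply: subset_leq_card.
  apply/fintype.subsetP => _ /imsetP[c + ->]; rewrite !inE wt_col_perm mxE skj.
  by move=> /andP[/andP[/sC-> ->] ->].
have n_const j : n j = n i by apply/eqP; rewrite eqn_leq !n_le.
have N_neq0 : N%:R != 0 :> R by rewrite pnatr_eq0 -lt0n (leq_trans _ (ltn_ord i)).
apply: (mulfI N_neq0).
have -> : N%:R * (n i)%:R = \sum_(j < N) (n j)%:R :> R.
  under eq_bigr do rewrite n_const.
  by rewrite sumr_const card_ord mulr_natl.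
under eq_bigr do rewrite /n natr_card_setId.
rewrite exchange_big /= (eq_bigr (fun=> alpha * N%:R)); last first.
  move=> c; rewrite inE => /andP[_ /eqP <-].
  rewrite /wt -sum1_card natr_sum big_mkcond [RHS]big_mkcond /=.
  by apply: eq_bigr => j _; rewrite inE; case: (c 0 j != 0).
by rewrite sumr_const -mulr_natr; ring.
Qed.

Definition symbol_pmf (R : realType) (F : finFieldType) (alpha : R) (x : F) : R :=
  if x == 0 then 1 - alpha else alpha / (#|F|%:R - 1).

Section SymbolPmf.
Variables (R : realType) (F : finFieldType) (alpha : R).
Hypotheses (h0 : 0 < alpha) (h1 : alpha < 1).

Let q_gt1 : 1 < #|F|%:R :> R.
Proof. by rewrite ltr1n card_finNzRing_gt1. Qed.

Lemma symbol_pmf_gt0 (x : F) : 0 < symbol_pmf alpha x.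
Proof.
by rewrite /symbol_pmf; case: ifP => _; rewrite ?subr_gt0// divr_gt0// subr_gt0.
Qed.

Lemma sum_symbol_pmf : \sum_(x : F) symbol_pmf alpha x = 1.
Proof.
rewrite (bigD1 0)//= /symbol_pmf eqxx.
rewrite (eq_bigr (fun=> alpha / (#|F|%:R - 1))); last by move=> x /negPf->.
rewrite sumr_const; have -> : #|(fun x : F => x != 0)| = #|F|.-1.
  by rewrite (cardD1 0 F) inE /=; apply: eq_card => x; rewrite !inE andbT.
have predqE : #|F|.-1%:R = #|F|%:R - 1 :> R.
  by rewrite -subn1 natrB// ltnW// card_finNzRing_gt1.
by rewrite -[X in _ + X]mulr_natr predqE divfK ?subrK// subr_eq0 gt_eqF.
Qed.

(** Each term is affine in the indicator of [c 0 i != 0], so only the number of such words matters.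
    The factor [ln #|F|%:R] converts base-q logarithms to natural ones. *)
Lemma sum_ln_symbol_pmf (N : nat) (C : {vspace 'rV[F]_N}) (i : 'I_N) :
  transitive_code C ->
  \sum_(c in weight_slice C alpha) ln (symbol_pmf alpha (c 0 i)) =
  - (#|weight_slice C alpha|%:R * (qentropy #|F|%:R alpha * ln #|F|%:R)).
Proof.
move=> hC; set S := weight_slice C alpha.
set a := ln (1 - alpha); set b := ln (alpha / (#|F|%:R - 1)).
transitivity (\sum_(c in S) (a + (b - a) * (c 0 i != 0)%:R)).
  apply: eq_bigr => c _; rewrite /symbol_pmf; case: eqP => _ /=.
    by rewrite mulr0 addr0.
  by rewrite mulr1 subrKC.
rewrite big_split /= -mulr_sumr sumr_const -mulr_natl.
have -> : \sum_(c in S) (c 0 i != 0)%:R = alpha * #|S|%:R.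
  by rewrite -(card_weight_slice_neq0 _ i hC) natr_card_setId.
have lnq_neq0 : ln (#|F|%:R : R) != 0 by rewrite gt_eqF// ln_gt0.
have -> : b = - ln ((#|F|%:R - 1) / alpha).
  by rewrite -lnV ?posrE ?divr_gt0 ?subr_gt0// invf_div.
have -> : a = - ln (1 / (1 - alpha)).
  by rewrite div1r lnV ?posrE ?subr_gt0// opprK.
by rewrite /qentropy /logb; field.
Qed.

Lemma card_weight_slice_le (N : nat) (C : {vspace 'rV[F]_N}) :
  transitive_code C ->
  #|weight_slice C alpha|%:R
    <= expR ((\dim C)%:R * (qentropy #|F|%:R alpha * ln #|F|%:R)).
Proof.
move=> hC; set S := weight_slice C alpha.
(* The empty slice is set aside because the last step divides by [#|S|] and takes its logarithm. *)
have [->|S_neq0] := eqVneq S finset.set0; first by rewrite cards0 expR_ge0.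
have S_gt0 : 0 < #|S|%:R :> R by rewrite ltr0n card_gt0.
have [f f_inj] := information_set C.
pose p := @symbol_pmf R F alpha.
pose Q (y : {ffun 'I_(\dim C) -> F}) := \prod_j p (y j).
pose g (c : 'rV[F]_N) := [ffun j => c 0 (f j)].
have g_inj : {in S &, injective g}.
  by move=> c d /[!inE] /andP[Cc _] /andP[Cd _]; exact: f_inj.
have Q_gt0 y : 0 < Q y by apply: prodr_gt0 => j _; exact: symbol_pmf_gt0.
have sumQg_le1 : \sum_(c in S) Q (g c) <= 1.
  have <- : \sum_y Q y = 1.
    (* The total mass of the product distribution factors into one sum per coordinate, each equal to
       1. *)
    rewrite -(bigA_distr_bigA (fun=> p)) big1// => j _.
    exact: sum_symbol_pmf.
  rewrite -(big_imset Q g_inj) [leRHS](bigID (mem (g @: S)))/=.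
  by rewrite lerDl sumr_ge0// => y _; exact: ltW.
have := card_ln_le (fun c _ => Q_gt0 (g c)) sumQg_le1.
have lnQ c : ln (Q (g c)) = \sum_j ln (p (c 0 (f j))).
  rewrite ln_prod => [|j]; last exact: symbol_pmf_gt0.
  by apply: eq_bigr => j _; rewrite ffunE.
under eq_bigr do rewrite lnQ.
(* Every selected coordinate contributes the same amount, so only their number [\dim C] remains. *)
rewrite exchange_big /= (eq_bigr _ (fun j _ => sum_ln_symbol_pmf (f j) hC)).
rewrite sumr_const card_ord -mulNrn opprK -[X in _ <= X]mulr_natl mulrCA.
rewrite ler_pM2l// => lnS_le.
by rewrite -[leLHS]lnK ?posrE// ler_expR.
Qed.

End SymbolPmf.

Theorem theorem1p1 (R : realType) (F : finFieldType) (N : nat)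
    (C : {vspace 'rV[F]_N}) (hC : transitive_code C)
    (alpha : R) (h0 : 0 < alpha) (h1 : alpha < 1) :
  Pr (uniform_pmf R (mem C)) (fun c : 'rV[F]_N => (wt c)%:R == alpha * N%:R)
    <= (#|F|%:R : R) `^ (- ((1 - qentropy #|F|%:R alpha) * (\dim C)%:R)).
Proof.
have q_gt0 : 0 < #|F|%:R :> R by rewrite ltr0n (ltnW (card_finNzRing_gt1 F)).
have -> : Pr (uniform_pmf R (mem C))
    (fun c : 'rV[F]_N => (wt c)%:R == alpha * N%:R)
    = #|weight_slice C alpha|%:R / #|F|%:R ^+ \dim C.
  rewrite /Pr /uniform_pmf card_vspace natrX mulr_natl -[RHS]sumr_const.
  rewrite big_mkcond [RHS]big_mkcond /=; apply: eq_bigr => c _.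
  by rewrite inE; case: (_ \in C); case: (_ == _).
(* Both powers of q become exponentials. Moving the denominator [#|C|] to the right then cancels the
   1 in [1 - qentropy #|F|%:R alpha]. *)
rewrite /powR gt_eqF// -[X in _ / X]lnK ?posrE ?exprn_gt0// lnXn//.
rewrite ler_pdivrMr ?expR_gt0// -expRD.
apply: le_trans (card_weight_slice_le h0 h1 hC) _; rewrite ler_expR.
by rewrite -mulr_natl; lra.
Qed.
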